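(* There exists an absolute constant $c>0$ such that the following holds for every integer $n\ge 1$. Let $A=\{a_1,\dots,a_n\}\subset\mathbb{R}$ and $B=\{b_1,\dots,b_n\}\subset\mathbb{R}$ be sets of $n$ distinct real numbers. Then $$|\Sigma(A,B)|\ \ge\ c\,n^3,$$ where $\Sigma(A,B)=\bigl\{\sum_{i=1}^n a_i b_{\pi(i)}:\ \pi\in S_n\bigr\}$.
   Context: $S_n$ denotes the group of all permutations of $\{1,\dots,n\}$. For sets $A=\{a_1,\dots,a_n\}$, $B=\{b_1,\dots,b_n\}$ of $n$ distinct reals and $\pi\in S_n$, put $S(\pi)=\sum_{i=1}^n a_i b_{\pi(i)}$; $\Sigma(A,B)=\{S(\pi):\pi\in S_n\}$ is the set of distinct values taken by $S$. *)

(* Defs.v *)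
From HB Require Import structures.
From mathcomp Require Import all_boot all_order all_algebra all_fingroup.
From mathcomp Require Import finmap reals.

Set Implicit Arguments.
Unset Strict Implicit.
Unset Printing Implicit Defensive.

Import GRing.Theory Num.Theory.
Local Open Scope ring_scope.

(* A set of n distinct reals is given by an injective enumeration
   a : 'I_n -> R; indices run over 0, ..., n - 1. *)

Definition perm_sum (R : realType) (n : nat) (a b : 'I_n -> R) (s : 'S_n) : R :=
  \sum_(i < n) a i * b (s i).

Definition Sigma (R : realType) (n : nat) (a b : 'I_n -> R) : {fset R} :=
  [fset perm_sum a b s | s : 'S_n]%fset.

(* Main.v *)
(** Sort both sets and cut them into k ~ n/2 pairs of consecutive elements
    ("blocks"); let x_i and y_j be the gaps inside the blocks of A and B.
    A bubble sort of the blocks of B gives a decreasing chain of about k^2/2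
    values of S.  The step that exchanges the blocks u < v of B, at places p and
    p+1, decreases S by more than x_p (y_(u+1) + ... + y_(v-1)), and the blocks
    of B numbered between u and v sit at places i < p.  Reversing the matching
    inside block i costs x_i y_j, so doing it successively for the i < p with
    x_i <= x_p yields that many further values before the next link of the
    chain.  Summed over the chain this counts, with weights of order k, the
    pairs i < p with x_i <= x_p.  Replacing A and B by -A and -B leaves
    the set of sums unchanged and reverses the sequence x; every pair is counted
    for x or for its reversal, so one of the two counts is of order k^3. *)

Require Import Defs.
From HB Require Import structures.
From mathcomp Require Import all_boot all_order all_algebra all_fingroup.
From mathcomp Require Import finmap reals.
From mathcomp Require Import zify ring lra.

Set Implicit Arguments.
Unset Strict Implicit.
Unset Printing Implicit Defensive.

Import GRing.Theory Num.Theory.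
Local Open Scope ring_scope.

(** * Counting values in consecutive half-open intervals *)

Section ManyValues.
Context {R : realType}.
Implicit Types (P : R -> Prop) (lo mid hi : R) (n m : nat).

(* Half-open intervals make the counts of adjacent intervals add up. *)
Definition many P lo hi n :=
  lo <= hi /\ exists s : seq R,
    [/\ uniq s, (n <= size s)%N & {in s, forall x, lo < x <= hi /\ P x}].

Lemma many0 P lo hi : lo <= hi -> many P lo hi 0.
Proof. by move=> le; split=> //; exists [::]. Qed.

Lemma many1 P lo hi : lo < hi -> P hi -> many P lo hi 1.
Proof.
move=> lt Phi; split; first exact: Order.POrderTheory.ltW.
by exists [:: hi]; split=> // x; rewrite inE => /eqP ->; rewrite lt Order.POrderTheory.lexx.
Qed.

Lemma many_cat P lo mid hi m n :
  many P lo mid m -> many P mid hi n -> many P lo hi (n + m).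
Proof.
move=> [lm [s [us ms Hs]]] [mh [t [ut nt Ht]]]; split.
  exact: Order.POrderTheory.le_trans mh.
exists (t ++ s); split; last 1 first.
- move=> x; rewrite mem_cat => /orP[/Ht|/Hs] [/andP[l1 l2] Px]; split=> //.
    by rewrite (Order.POrderTheory.le_lt_trans lm l1) l2.
  by rewrite l1 (Order.POrderTheory.le_trans l2 mh).
- rewrite cat_uniq ut us andbT /=; apply/hasPn => x /Hs [/andP[_ xm] _].
  by apply/negP => /Ht [/andP[mx _] _]; lra.
- by rewrite size_cat leq_add.
Qed.

(** The chain [u] runs downwards, as bubble sort lowers the sum at each step. *)
Lemma many_sum P (u : nat -> R) (f : nat -> nat) N :
  (forall t, (t < N)%N -> many P (u t.+1) (u t) (f t)) ->
  many P (u N) (u 0) (\sum_(t < N) f t)%N.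
Proof.
elim: N => [|N IH] H; first by rewrite big_ord0; exact: many0.
rewrite big_ord_recr /=; apply: many_cat (H N _) (IH _) => // t tN.
by apply: H; exact: ltnW.
Qed.

Lemma many_card P lo hi n (S : {fset R}) :
  (forall x, P x -> x \in S) -> many P lo hi n -> (n <= #|` S|)%N.
Proof.
move=> PS [_ [s [us ns Hs]]]; apply: leq_trans ns _.
rewrite -(undup_id us) -card_fseq; apply: fsubset_leq_card.
by apply/fsubsetP => x; rewrite in_fset => /Hs [_ /PS].
Qed.

End ManyValues.

(** * Symmetries of the set of sums, restriction to fewer indices, sorting *)

Section SigmaSets.
Context {R : realType}.

Lemma mem_Sigma n (a b : 'I_n -> R) s : perm_sum a b s \in Sigma a b.
Proof. by apply/imfsetP; exists s. Qed.

Lemma perm_sum_reindex n (a b : 'I_n -> R) (s t u : 'S_n) :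
  perm_sum (a \o s) (b \o t) u = perm_sum a b (s^-1 * u * t).
Proof.
rewrite /perm_sum [RHS](reindex_inj (@perm_inj _ s)) /=.
by apply: eq_bigr => i _; rewrite !permM permK.
Qed.

Lemma Sigma_reindex n (a b : 'I_n -> R) (s t : 'S_n) :
  Sigma (a \o s) (b \o t) = Sigma a b.
Proof.
apply/fsetP => x; apply/imfsetP/imfsetP => /= -[u _ ->].
  by exists (s^-1 * u * t)%g => //; rewrite perm_sum_reindex.
exists (s * u * t^-1)%g => //; rewrite perm_sum_reindex.
by rewrite !mulgA mulVg mul1g -mulgA mulVg mulg1.
Qed.

Lemma SigmaN n (a b : 'I_n -> R) :
  Sigma (fun i => - a i) (fun i => - b i) = Sigma a b.
Proof.
have E s : perm_sum (fun i => - a i) (fun i => - b i) s = perm_sum a b s.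
  by apply: eq_bigr => i _; rewrite mulrNN.
by apply/fsetP => x; apply/imfsetP/imfsetP => /= -[u _ ->]; exists u.
Qed.

Lemma eq_Sigma n (a b a' b' : 'I_n -> R) :
  a =1 a' -> b =1 b' -> Sigma a b = Sigma a' b'.
Proof.
move=> ea eb.
have E s : perm_sum a b s = perm_sum a' b' s.
  by apply: eq_bigr => i _; rewrite ea eb.
by apply/fsetP => x; apply/imfsetP/imfsetP => /= -[u _ ->]; exists u.
Qed.

(** Permutations fixing the last index realize every smaller sum, translated by the constant last
    product. *)
Lemma card_Sigma_widenS n (a b : 'I_n.+1 -> R) :
  (#|` Sigma (a \o widen_ord (leqnSn n)) (b \o widen_ord (leqnSn n))|
   <= #|` Sigma a b|)%N.
Proof.
set w := widen_ord _.
have wE i : w i = lift ord_max i by apply: val_inj; rewrite /= /bump leqNgt ltn_ord.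
pose f (x : R) := x + a ord_max * b ord_max.
have -> : #|` Sigma (a \o w) (b \o w)| = #|` f @` Sigma (a \o w) (b \o w)|%fset.
  by apply/esym/card_imfset => x y /addIr.
apply: fsubset_leq_card; apply/fsubsetP => _ /imfsetP[_ /imfsetP[s _ ->] ->] /=.
apply/imfsetP; exists (lift_perm ord_max ord_max s) => //.
rewrite /perm_sum big_ord_recr /= lift_perm_id; congr (_ + _).
by apply: eq_bigr => i _; rewrite -/w !wE lift_perm_lift.
Qed.

Lemma card_Sigma_widen m n (mn : (m <= n)%N) (a b : 'I_n -> R) :
  (#|` Sigma (a \o widen_ord mn) (b \o widen_ord mn)| <= #|` Sigma a b|)%N.
Proof.
elim: n mn a b => [|n IH] mn a b.
  have := mn; rewrite leqn0 => /eqP m0; subst m.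
  by rewrite (@eq_Sigma _ _ _ a b) // => i; case: i.
have := mn; rewrite leq_eqVlt => /orP[/eqP e|mn'].
  subst m; rewrite (@eq_Sigma _ _ _ a b) // => i /=; congr (_ _); exact: val_inj.
apply: leq_trans (card_Sigma_widenS a b); apply: leq_trans (IH mn' _ _).
by rewrite (@eq_Sigma _ _ _ (a \o widen_ord (leqnSn n) \o widen_ord (mn' : (m <= n)%N))
  (b \o widen_ord (leqnSn n) \o widen_ord (mn' : (m <= n)%N))) // => i /=;
  congr (_ _); exact: val_inj.
Qed.

(** The sorted values are extended to [nat], so that later index arithmetic avoids ordinals. *)
Lemma sorting_perm n (a : 'I_n -> R) : injective a ->
  exists (s : 'S_n) (f : nat -> R),
    (forall i : 'I_n, f i = a (s i)) /\
    (forall i j, (i < j < n)%N -> f i < f j).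
Proof.
move=> ia; pose t := [tuple a i | i < n].
have /tuple_permP[p pE] : perm_eq (sort <=%R t) t by rewrite perm_sort.
exists p, (nth 0 (sort <=%R t)); split=> [i|i j /andP[ij jn]].
  by rewrite pE -tnth_nth !tnth_mktuple.
have st : sorted <%R (sort <=%R t).
  rewrite Order.TotalTheory.sort_lt_sorted.
  by rewrite map_inj_uniq ?enum_uniq.
by apply: (sorted_ltn_nth Order.POrderTheory.lt_trans) => //;
  rewrite inE size_sort size_tuple // (ltn_trans ij).
Qed.

End SigmaSets.

(** * Block matchings and the bubble-sort chain *)

Definition gap (R : realType) (f : nat -> R) i := f i.*2.+1 - f i.*2.

Definition ascents (R : realType) (z : nat -> R) p : nat :=
  (\sum_(i < p) (z i <= z p)%R)%N.

Section BlockMatchings.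
Variables (R : realType) (k : nat) (al be : nat -> R).
Hypothesis al_incr : forall i j, (i < j < k.*2)%N -> al i < al j.
Hypothesis be_incr : forall i j, (i < j < k.*2)%N -> be i < be j.

Local Notation x := (gap al).
Local Notation y := (gap be).
(** Contribution of two matched blocks when their elements are paired in increasing order. *)
Let D i j := al i.*2 * be j.*2 + al i.*2.+1 * be j.*2.+1.

Definition Sigma_nat : {fset R} :=
  Sigma (fun i : 'I_k.*2 => al i) (fun i : 'I_k.*2 => be i).

Lemma sum_double n (f : nat -> R) :
  \sum_(i < n.*2) f i = \sum_(i < n) (f i.*2 + f i.*2.+1).
Proof.
elim: n => [|n IH]; first by rewrite !big_ord0.
by rewrite doubleS !big_ord_recr /= IH addrA.
Qed.

(** Here [m] matches the blocks and [I] selects those matched inside in reverse; reversing block [i]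
    turns [D i (m i)] into [D i (m i) - x i * y (m i)]. *)
Lemma block_mem_Sigma (m : nat -> nat) (I : pred nat) :
    (forall i, (i < k)%N -> (m i < k)%N) ->
    (forall i j, (i < k)%N -> (j < k)%N -> m i = m j -> i = j) ->
  \sum_(i < k) (D i (m i) - (if I i then x i * y (m i) else 0)) \in Sigma_nat.
Proof.
move=> mk minj.
(* The parity of [j] is its position inside the block; [I] toggles it. *)
pose g j := ((m j./2).*2 + (odd j (+) I j./2))%N.
have g_lt (j : 'I_k.*2) : (g j < k.*2)%N.
  have /mk : (j./2 < k)%N by have := ltn_ord j; lia.
  by rewrite /g; case: (_ (+) _); lia.
have g_inj : injective (fun j : 'I_k.*2 => Ordinal (g_lt j)).
  move=> i j /(congr1 val) /=; rewrite /g => gE.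
  have hi : (i./2 < k)%N by have := ltn_ord i; lia.
  have hj : (j./2 < k)%N by have := ltn_ord j; lia.
  have e2 : i./2 = j./2.
    by apply: minj => //; move: gE; case: (_ (+) _); case: (_ (+) _); lia.
  have eo : odd i = odd j.
    move: gE; rewrite e2; case: (odd i); case: (odd j); case: (I _) => //=; lia.
  by apply: val_inj; rewrite /= -(odd_double_half i) -(odd_double_half j) e2 eo.
suff -> : \sum_(i < k) (D i (m i) - (if I i then x i * y (m i) else 0)) =
   perm_sum (fun i : 'I_k.*2 => al i) (fun i : 'I_k.*2 => be i) (perm g_inj).
  exact: mem_Sigma.
rewrite /perm_sum; under [RHS]eq_bigr do rewrite permE /=.
rewrite (sum_double k (fun j => al j * be (g j))).
apply: eq_bigr => i _; rewrite /g /= !odd_double uphalf_double doubleK /D /gap.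
by case: (I i) => /=; rewrite ?addn0 ?addn1; ring.
Qed.

(* Stage [p] of phase [r] of a bubble sort: the blocks of [b] numbered [< r]
   have already been moved, in turn, to the far end, and block [r] has advanced
   to place [p]; [bubble r p i] is the block of [b] matched with block [i] of
   [a]. *)
Definition bubble r p i : nat :=
  if (i < p)%N then (i + r).+1
  else if (k - r <= i)%N then (k - i).-1
  else if i == p then r else (i + r)%N.

Definition bubble_val r p := \sum_(i < k) D i (bubble r p i).

Definition flippable p i := (i < p)%N && (x i <= x p).

(** For [i < p] the partner [bubble r p i] is [(i + r).+1], whence the index of [y]. *)
Definition flip_cost r p q :=
  \sum_(i < q) (if flippable p i then x i * y (i + r).+1 else 0).

Lemma x_gt0 i : (i < k)%N -> 0 < x i.
Proof. by move=> ik; rewrite subr_gt0 al_incr //; lia. Qed.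

Lemma y_gt0 i : (i < k)%N -> 0 < y i.
Proof. by move=> ik; rewrite subr_gt0 be_incr //; lia. Qed.

Lemma bubble_flip_mem r p q : (p < k - r)%N -> (q <= p)%N ->
  bubble_val r p - flip_cost r p q \in Sigma_nat.
Proof.
move=> pk qp.
have := @block_mem_Sigma (bubble r p) (fun i => (i < q)%N && flippable p i).
have -> : \sum_(i < k) (D i (bubble r p i) -
      (if (i < q)%N && flippable p i then x i * y (bubble r p i) else 0)) =
    bubble_val r p - flip_cost r p q.
  rewrite big_split /= sumrN; congr (_ - _).
  rewrite /flip_cost (big_ord_widen k (fun i =>
    if flippable p i then x i * y (i + r).+1 else 0)); last lia.
  rewrite [RHS]big_mkcond /=; apply: eq_bigr => i _.
  case: ltnP => //= iq; rewrite /bubble /flippable (leq_trans iq qp) //.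
by apply=> [i|i j] ik; [|move=> jk]; rewrite /bubble;
  do ?[case: ifP => ?]; lia.
Qed.

(** Blocks [r] and [(p + r).+1] of [b] trade places [p] and [p.+1]; all other terms cancel. *)
Lemma bubble_step r p : (p.+1 < k - r)%N ->
  bubble_val r p - bubble_val r p.+1 =
    (al p.+1.*2 - al p.*2) * (be (p + r).+1.*2 - be r.*2) +
    (al p.+1.*2.+1 - al p.*2.+1) * (be (p + r).+1.*2.+1 - be r.*2.+1).
Proof.
move=> pk; rewrite /bubble_val -sumrB.
have pk0 : (p < k)%N by lia.
have pk1 : (p.+1 < k)%N by lia.
rewrite (bigD1 (Ordinal pk0)) //= (bigD1 (Ordinal pk1)) /=; last first.
  by rewrite -val_eqE /=; lia.
rewrite big1 => [|i]; last first.
  rewrite -!val_eqE /= => /andP[ip ip1].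
  suff -> : bubble r p i = bubble r p.+1 i by rewrite subrr.
  by have := ltn_ord i; rewrite /bubble; do ?[case: ifP => ?]; lia.
have -> : bubble r p p = r by rewrite /bubble; do ?[case: ifP => ?]; lia.
have -> : bubble r p.+1 p.+1 = r by rewrite /bubble; do ?[case: ifP => ?]; lia.
have -> : bubble r p.+1 p = (p + r).+1 by rewrite /bubble ltnSn.
have -> : bubble r p p.+1 = (p + r).+1.
  by rewrite /bubble; do ?[case: ifP => ?]; lia.
by rewrite /D; ring.
Qed.

(** The gaps are lengths of disjoint intervals lying between the upper ends of blocks [r] and
    [q + r]. *)
Lemma sum_y_le r q : (q + r < k)%N ->
  \sum_(i < q) y (i + r).+1 <= be (q + r).*2.+1 - be r.*2.+1.
Proof.
elim: q => [|q IH] qk; first by rewrite big_ord0 add0n subrr.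
rewrite big_ord_recr /= addSn.
have /IH H : (q + r < k)%N by lia.
have : be (q + r).*2.+1 < be (q + r).+1.*2 by apply: be_incr; lia.
by rewrite /gap; lra.
Qed.

Lemma flip_cost_lt r p : (p.+1 < k - r)%N ->
  flip_cost r p p < bubble_val r p - bubble_val r p.+1.
Proof.
move=> pk; rewrite bubble_step //.
have xp : 0 < x p by apply: x_gt0; lia.
have H1 : flip_cost r p p <= x p * \sum_(i < p) y (i + r).+1.
  rewrite mulr_sumr; apply: ler_sum => i _; have ip := ltn_ord i.
  have yp : 0 < y (i + r).+1 by apply: y_gt0; lia.
  rewrite /flippable ip /=; case: ifP => h; first by rewrite ler_pM2r.
  by rewrite mulr_ge0 ?Order.POrderTheory.ltW.
have H2 : \sum_(i < p) y (i + r).+1 <= be (p + r).*2.+1 - be r.*2.+1.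
  by apply: sum_y_le; lia.
have H3 : x p * \sum_(i < p) y (i + r).+1 <= x p * (be (p + r).*2.+1 - be r.*2.+1).
  by rewrite ler_pM2l.
have a1 : al p.*2.+1 < al p.+1.*2 by apply: al_incr; lia.
have a2 : al p.+1.*2 < al p.+1.*2.+1 by apply: al_incr; lia.
have b1 : be (p + r).*2.+1 < be (p + r).+1.*2 by apply: be_incr; lia.
have b2 : be (p + r).+1.*2 < be (p + r).+1.*2.+1 by apply: be_incr; lia.
have b3 : be r.*2 < be r.*2.+1 by apply: be_incr; lia.
have b4 : be r.*2.+1 <= be (p + r).*2.+1.
  by case: (posnP p) => [->|p0]; last by apply/Order.POrderTheory.ltW/be_incr; lia.
apply: Order.POrderTheory.le_lt_trans H1 _.
apply: Order.POrderTheory.le_lt_trans H3 _.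
(* The first product of the step beats the bound factor by factor; the second need only be
   positive. *)
rewrite /gap in xp *; rewrite -[ltLHS]addr0; apply: ltrD; last first.
  by apply: mulr_gt0; lra.
by apply: ltr_pM; lra.
Qed.

Lemma many_bubble_step r p : (p.+1 < k - r)%N ->
  many (fun v => v \in Sigma_nat) (bubble_val r p.+1) (bubble_val r p)
    (ascents x p).+1.
Proof.
move=> pk.
have fE q : flip_cost r p q.+1 = flip_cost r p q +
    (if flippable p q then x q * y (q + r).+1 else 0).
  by rewrite /flip_cost big_ord_recr.
(* A block that is not flippable gives an empty interval and counts 0. *)
have M q : (q < p)%N -> many (fun v => v \in Sigma_nat)
    (bubble_val r p - flip_cost r p q.+1) (bubble_val r p - flip_cost r p q)
    (x q <= x p)%R.
  move=> qp; rewrite fE /flippable qp /=; case: ifP => _; last first.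
    by apply: many0; rewrite addr0.
  apply: many1; last by apply: bubble_flip_mem; lia.
  have : 0 < x q * y (q + r).+1 by rewrite mulr_gt0 ?x_gt0 ?y_gt0 //; lia.
  lra.
have := @many_sum _ _ (fun q => bubble_val r p - flip_cost r p q) _ _ M.
(* The extra value is the one after all flips, still strictly above the next link. *)
rewrite {2}/flip_cost big_ord0 subr0 -[(ascents x p).+1]addn1.
apply: many_cat; apply: many1; last by apply: bubble_flip_mem; lia.
by have := flip_cost_lt pk; lra.
Qed.

Lemma many_bubble :
  many (fun v => v \in Sigma_nat) (bubble_val k 0) (bubble_val 0 0)
    (\sum_(r < k) \sum_(p < (k - r).-1) (ascents x p).+1)%N.
Proof.
apply: (@many_sum R _ (fun r => bubble_val r 0)
  (fun r => \sum_(p < (k - r).-1) (ascents x p).+1)%N) => r rk.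
(* Once block [r] is at its final place, phase [r.+1] has begun. *)
have -> : bubble_val r.+1 0 = bubble_val r (k - r).-1.
  apply: eq_bigr => i _; congr (D _ _); have := ltn_ord i.
  by rewrite /bubble; do ?[case: ifP => ?]; lia.
apply: (@many_sum R _ (bubble_val r) (fun p => (ascents x p).+1)) => p pk.
by apply: many_bubble_step; lia.
Qed.

Lemma card_Sigma_nat :
  (\sum_(r < k) \sum_(p < (k - r).-1) (ascents x p).+1 <= #|` Sigma_nat|)%N.
Proof. by apply: many_card many_bubble. Qed.

End BlockMatchings.

(** * Summation over the chain, reversal and the cubic bound *)

Lemma leq_sum_ord m n (f : nat -> nat) : (m <= n)%N ->
  (\sum_(i < m) f i <= \sum_(i < n) f i)%N.
Proof.
move=> mn; rewrite (big_ord_widen n f mn) big_mkcond /=.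
by apply: leq_sum => i _; case: ifP.
Qed.

(** Each of the first [h] phases passes all places of the middle third [[h, 2h)]. Only ascents
    inside that third are kept, because reversing the [3 * h] blocks maps it to itself. *)
Lemma card_Sigma_nat_ascents (R : realType) h (al be : nat -> R) :
    (forall i j, (i < j < (3 * h).*2)%N -> al i < al j) ->
    (forall i j, (i < j < (3 * h).*2)%N -> be i < be j) ->
  (h * \sum_(p < h) (ascents (fun i => gap al (h + i)) p).+1
     <= #|` Sigma_nat (3 * h) al be|)%N.
Proof.
move=> al_incr be_incr; apply: leq_trans (card_Sigma_nat al_incr be_incr).
have hh : (h <= 3 * h)%N by lia.
apply: leq_trans (leq_sum_ord
  (fun r => \sum_(p < (3 * h - r).-1) (ascents (gap al) p).+1) hh)%N.
rewrite -[h in (h * _)%N]card_ord -sum_nat_const; apply: leq_sum => r _.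
have hr : (h + h <= (3 * h - r).-1)%N by have := ltn_ord r; lia.
apply: leq_trans (leq_sum_ord (fun p => (ascents (gap al) p).+1) hr).
rewrite big_split_ord /=; apply: leq_trans (leq_addl _ _).
apply: leq_sum => p _; rewrite ltnS /ascents big_split_ord /=.
exact: leq_addl.
Qed.

Lemma Sigma_nat_rev (R : realType) k (al be : nat -> R) :
  Sigma_nat k (fun j => - al (k.*2.-1 - j)%N) (fun j => - be (k.*2.-1 - j)%N)
  = Sigma_nat k al be.
Proof.
rewrite /Sigma_nat SigmaN.
rewrite -[RHS](Sigma_reindex _ _ (perm (@rev_ord_inj _)) (perm (@rev_ord_inj _))).
by apply: eq_Sigma => i /=; rewrite permE /=; congr (_ _); lia.
Qed.

(* Each pair [i < p] is an ascent of [z] or of the reversal of [z]. *)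
Lemma ascents_rev (R : realType) h (z z' : nat -> R) :
    (forall i, (i < h)%N -> z' i = z (h.-1 - i)%N) ->
  (h ^ 2 <= 2 * (\sum_(p < h) (ascents z p).+1 + \sum_(p < h) (ascents z' p).+1))%N.
Proof.
move=> z'E.
have E u : (\sum_(p < h) (ascents u p).+1 =
    \sum_(p < h) (\sum_(i < h) ((i < p)%N && (u i <= u p)%R)).+1)%N.
  apply: eq_bigr => p _; congr _.+1; rewrite /ascents.
  rewrite (big_ord_widen h (fun i => (u i <= u p)%R : nat)); last exact: ltnW.
  by rewrite big_mkcond; apply: eq_bigr => i _; case: ifP.
have E' : (\sum_(p < h) (ascents z' p).+1 =
    \sum_(p < h) (\sum_(i < h) ((p < i)%N && (z i <= z p)%R)).+1)%N.
  rewrite E (reindex_inj rev_ord_inj) /=; apply: eq_bigr => p _; congr _.+1.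
  rewrite (reindex_inj rev_ord_inj) /=; apply: eq_bigr => i _.
  have hi := ltn_ord i; have hp := ltn_ord p.
  rewrite !z'E; try lia.
  by congr (nat_of_bool (_ && (z _ <= z _))); lia.
rewrite E E' -big_split /=.
set T := (\sum_(p < h) \sum_(i < h) (z i <= z p)%R)%N.
(* By totality, each ordered pair or its transpose is counted in [T]. *)
have T2 : (h ^ 2 <= T + T)%N.
  rewrite {2}/T exchange_big -big_split /=.
  rewrite -[h in (h ^ 2)%N]card_ord expnS expn1 -sum_nat_const.
  apply: leq_sum => p _; rewrite -big_split /= -sum1_card.
  apply: leq_sum => i _.
  by case: (Order.TotalTheory.leP (z i) (z p)) => //= /Order.POrderTheory.ltW ->.
rewrite mul2n -addnn; apply: leq_trans T2 _.
suff H : (T <= \sum_(p < h) ((\sum_(i < h) ((i < p)%N && (z i <= z p)%R)).+1 +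
   (\sum_(i < h) ((p < i)%N && (z i <= z p)%R)).+1))%N by rewrite leq_add.
apply: leq_sum => p _; rewrite addSn addnS -big_split /=.
(* One of the two successors pays for the diagonal term [i = p]; the other is dropped. *)
rewrite (bigD1 p) //=; apply: leq_trans (leqnSn _).
apply: (@leq_add _ _ 1); first exact: leq_b1.
rewrite big_mkcond /=; apply: leq_sum => i _; rewrite -val_eqE /=.
by case: ltngtP; case: (_ <= _)%R.
Qed.

(** The ascent sums of both orders, each times [h], are at most the cardinality, and twice their
    total is at least [h ^ 2]; hence the factor 4. *)
Lemma card_Sigma_nat_cube (R : realType) h (al be : nat -> R) :
    (forall i j, (i < j < (3 * h).*2)%N -> al i < al j) ->
    (forall i j, (i < j < (3 * h).*2)%N -> be i < be j) ->
  (h ^ 3 <= 4 * #|` Sigma_nat (3 * h) al be|)%N.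
Proof.
move=> al_incr be_incr.
have H1 := card_Sigma_nat_ascents al_incr be_incr.
have rev_incr (f : nat -> R) :
    (forall i j, (i < j < (3 * h).*2)%N -> f i < f j) ->
  forall i j, (i < j < (3 * h).*2)%N ->
    - f ((3 * h).*2.-1 - i)%N < - f ((3 * h).*2.-1 - j)%N.
  by move=> f_incr i j ij; rewrite ltrN2 f_incr //; lia.
have := card_Sigma_nat_ascents (rev_incr _ al_incr) (rev_incr _ be_incr).
rewrite Sigma_nat_rev => H2.
pose z i := gap al (h + i).
pose z' i := gap (fun j => - al ((3 * h).*2.-1 - j)%N) (h + i).
have z'E i : (i < h)%N -> z' i = z (h.-1 - i)%N.
  by move=> ih; rewrite /z' /z /gap opprK addrC; congr (al _ - al _); lia.
have := ascents_rev z'E.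
move: H1 H2; set s1 := (\sum_(_ < h) _)%N; set s2 := (\sum_(_ < h) _)%N.
set N := #|` _|; rewrite !expnS expn0; nia.
Qed.

Theorem theorem1p1 (R : realType) :
  exists c : R, 0 < c /\
    forall (n : nat) (a b : 'I_n -> R),
      (1 <= n)%N -> injective a -> injective b ->
      c * n%:R ^+ 3 <= (#|` Sigma a b|)%:R.
Proof.
exists (12 ^ 3 * 4)%:R^-1; split=> [|n a b n1 ia ib]; first by rewrite invr_gt0 ltr0n.
suff H : (n ^ 3 <= 12 ^ 3 * 4 * #|` Sigma a b|)%N.
  by rewrite ler_pdivrMl ?ltr0n // -natrX -natrM ler_nat.
have S1 : (1 <= #|` Sigma a b|)%N.
  by rewrite cardfs_gt0; apply/fset0Pn; exists (perm_sum a b 1); exact: mem_Sigma.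
(* The [3 * h] blocks of two elements use [6 * h] indices. *)
pose h := (n %/ 6)%N.
have hn : ((3 * h).*2 <= n)%N by rewrite /h; lia.
have := card_Sigma_widen hn a b.
set a' := a \o _; set b' := b \o _ => leS.
have [|s [al [alE al_incr]]] := @sorting_perm R _ a'.
  by move=> i j /ia /(congr1 val) /= ?; exact: val_inj.
have [|t [be [beE be_incr]]] := @sorting_perm R _ b'.
  by move=> i j /ib /(congr1 val) /= ?; exact: val_inj.
have := card_Sigma_nat_cube al_incr be_incr.
have -> : Sigma_nat (3 * h) al be = Sigma a' b'.
  by rewrite -(Sigma_reindex a' b' s t); apply: eq_Sigma.
move=> H; have {H leS} : (h ^ 3 <= 4 * #|` Sigma a b|)%N by lia.
(* For [n >= 6], [n < 6 * h + 6 <= 12 * h], which gives the factor [12 ^ 3]; for smaller [n] one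
   value suffices. *)
have : (n <= 12 * h \/ h = 0 /\ n < 6)%N by rewrite /h; lia.
case=> [nh H|[_ n6] _].
  apply: (@leq_trans ((12 * h) ^ 3)); first by rewrite leq_exp2r.
  by rewrite expnMn -mulnA leq_mul2l.
apply: (@leq_trans (6 ^ 3)); first by rewrite leq_exp2r // ltnW.
by apply: leq_trans (leq_pmulr _ S1).
Qed.
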